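(* Let $\Delta$ be a matroid on $[n]=\{1,\ldots,n\}$ and let ${}^{\operatorname{si}}\Delta$ be its simplified matroid. Then $\beta_i(S/J(\Delta))=\beta_i(S/J({}^{\operatorname{si}}\Delta))$ for all $i$. In particular, $\operatorname{type}(\Delta)=\operatorname{type}({}^{\operatorname{si}}\Delta)$.
   Context: A matroid on $[n]$ is identified with its simplicial complex $\Delta$ of independent sets (a simplicial complex such that for $F,G\in\Delta$ with $|F|<|G|$ there is $i\in G\setminus F$ with $F\cup\{i\}\in\Delta$); every $v\in[n]$ is assumed to be a vertex of $\Delta$. The $1$-skeleton of $\Delta$, viewed as a graph on $[n]$ whose edges are the two-element faces, is complete $p$-partite for some $p$, with partition sets $A_1,\ldots,A_p$ (so $\{v,w\}\in\Delta$, $v\neq w$, iff $v,w$ lie in different $A_i$). The simplified matroid ${}^{\operatorname{si}}\Delta$ is the restriction of $\Delta$ to a set $\{v_{1,1},\ldots,v_{p,1}\}$ containing one vertex $v_{i,1}\in A_i$ from each class, i.e. the set of faces of $\Delta$ contained in $\{v_{1,1},\ldots,v_{p,1}\}$ (up to isomorphism it does not depend on the choice). $\Bbbk$ is a field; for a simplicial complex $\Delta$ with vertices in a finite set $V$, $J(\Delta)=\bigcap_{F\text{ facet of }\Delta}(x_i : i\in F)$ is the cover ideal in the polynomial ring $S$ over $\Bbbk$ in variables $x_i$, $i\in V$ (for ${}^{\operatorname{si}}\Delta$ one may use either the $p$ variables corresponding to its vertices or all $n$ variables; the Betti numbers are the same). $\beta_i(S/J)=\dim_\Bbbk\operatorname{Tor}_i^S(S/J,\Bbbk)$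 are the total Betti numbers. For a $(d-1)$-dimensional $\Delta$ with $S/J(\Delta)$ Cohen–Macaulay (which holds for matroids), $\operatorname{type}(\Delta)=\beta_d(S/J(\Delta))$. *)

(* Defs.v *)
From mathcomp Require Import all_boot all_algebra.
From mathcomp.multinomials Require Import mpoly.
From Stdlib Require Import ClassicalEpsilon.

Set Implicit Arguments.
Unset Strict Implicit.
Unset Printing Implicit Defensive.

Import GRing.Theory.
Local Open Scope ring_scope.

Record matroid_complex (n : nat) (Delta : {set {set 'I_n}}) : Prop := {
  matroid_set0 : set0 \in Delta;
  matroid_vertex : forall v : 'I_n, [set v] \in Delta;
  matroid_down : forall F G : {set 'I_n},
    G \in Delta -> F \subset G -> F \in Delta;
  matroid_exchange : forall F G : {set 'I_n},
    F \in Delta -> G \in Delta -> (#|F| < #|G|)%N ->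
    exists2 i, i \in G :\: F & i |: F \in Delta
}.

(* The 1-skeleton of Delta is complete multipartite, and the blocks of P are
   its partition sets. *)
Definition complete_multipartite_skeleton (n : nat) (Delta P : {set {set 'I_n}})
    : Prop :=
  partition P [set: 'I_n] /\
  forall v w : 'I_n, v != w ->
    ([set v; w] \in Delta) = (pblock P v != pblock P w).

(* Meant for W = {v_(1,1), ..., v_(p,1)}, one vertex per partition set.  The
   result is a complex with vertex set W, but is kept in the subsets of 'I_n, so
   that its cover ideal lives in the polynomial ring in all n variables. *)
Definition restriction (n : nat) (Delta : {set {set 'I_n}}) (W : {set 'I_n})
    : {set {set 'I_n}} :=
  [set F in Delta | F \subset W].

Definition is_facet (n : nat) (Delta : {set {set 'I_n}}) (F : {set 'I_n}) : bool :=
  maxset (fun G => G \in Delta) F.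

Section CoverIdeal.
Variables (K : fieldType) (n : nat).
Implicit Types (I : {mpoly K[n]} -> Prop) (Delta : {set {set 'I_n}}).

Definition variable_ideal (F : {set 'I_n}) (f : {mpoly K[n]}) : Prop :=
  exists c : 'I_n -> {mpoly K[n]}, f = \sum_(i in F) c i * 'X_i.

Definition cover_ideal Delta (f : {mpoly K[n]}) : Prop :=
  forall F : {set 'I_n}, is_facet Delta F -> variable_ideal F f.

(* A resolution ... -> S^(rk 1) -> S^(rk 0) -> S/I -> 0 of S/I by free modules
   of finite rank, not necessarily minimal or graded.  Elements of S^m are row
   vectors and maps act by right multiplication; the augmentation
   S^(rk 0) -> S/I is u |-> u *m res_aug mod I. *)
Record free_resolution I := {
  res_rk : nat -> nat;
  res_aug : 'cV[{mpoly K[n]}]_(res_rk 0%N);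
  res_diff : forall i : nat, 'M[{mpoly K[n]}]_(res_rk i.+1, res_rk i);
  res_aug_surj : forall f : {mpoly K[n]},
    exists u : 'rV_(res_rk 0%N), I (f - (u *m res_aug) 0 0);
  res_aug_exact : forall u : 'rV_(res_rk 0%N),
    I ((u *m res_aug) 0 0) <-> exists v, u = v *m res_diff 0%N;
  res_diff_exact : forall (i : nat) (u : 'rV_(res_rk i.+1)),
    u *m res_diff i = 0 <-> exists v, u = v *m res_diff i.+1
}.

(* K is the S-module S/(x_1, ..., x_n): applying - (x)_S K to a matrix over S
   takes the constant coefficient of every entry. *)
Definition diff_residue I (R : free_resolution I) (i : nat)
    : 'M[K]_(res_rk R i.+1, res_rk R i) :=
  map_mx (fun f : {mpoly K[n]} => f@_0%MM) (res_diff R i).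

(* dim_K of the i-th homology of R (x)_S K.  The truncated subtraction is
   harmless, as images are contained in kernels. *)
Definition tor_dim I (R : free_resolution I) (i : nat) : nat :=
  match i with
  | 0 => (res_rk R 0 - \rank (diff_residue R 0))%N
  | j.+1 => (\rank (kermx (diff_residue R j)) - \rank (diff_residue R j.+1))%N
  end.

(* dim_K Tor_i^S(S/I, K), computed from any resolution as above: for an ideal I
   one exists because S is noetherian, and the dimension does not depend on it. *)
Definition betti I (i : nat) : nat :=
  epsilon (inhabits 0%N) (fun b => exists R : free_resolution I, b = tor_dim R i).

(* beta_d, where Delta has dimension d - 1. *)
Definition cm_type Delta : nat :=
  betti (cover_ideal Delta) (\max_(F in Delta) #|F|)%N.

End CoverIdeal.

Arguments cover_ideal K {n} Delta f.
Arguments cm_type K {n} Delta.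

(* Main.v *)
(** Both cover ideals are squarefree monomial ideals with generators indexed by
    the vertex covers T of the simplified matroid: x^T for the simplification,
    and x^{r^-1(T)} for Delta, where r sends a vertex to the representative of
    its parallel class.  This holds because exchanging elements of a face for
    parallel ones preserves faces and facets.  A redundant variant of the Taylor
    resolution, with basis the tuples of generators, resolves any squarefree
    monomial ideal; modulo the variables its differential only records which
    unions of generators coincide, and T |-> r^-1(T) preserves unions and their
    inclusions.  So both ideals have resolutions with the same residual complex,
    and the Betti numbers do not depend on the resolution. *)
Require Import Defs.
From mathcomp Require Import all_boot all_algebra.
From mathcomp.multinomials Require Import mpoly.
From Stdlib Require Import ClassicalEpsilon FunctionalExtensionality.
From Stdlib Require Import PropExtensionality.

Set Implicit Arguments.
Unset Strict Implicit.
Unset Printing Implicit Defensive.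

Import GRing.Theory.
Local Open Scope ring_scope.

(** * Linear algebra: matrices assembled row by row, and ranks of homology *)

Lemma choose_rows (R : Type) m p (Q : 'I_m -> 'rV[R]_p -> Prop) :
  (forall i, exists v, Q i v) ->
  exists A : 'M[R]_(m, p), forall i, Q i (row i A).
Proof.
move=> ex; have wit i := constructive_indefinite_description _ (ex i).
exists (\matrix_(i, j) sval (wit i) 0 j) => i.
suff ->: row i (\matrix_(i, j) sval (wit i) 0 j) = sval (wit i) by case: (wit i).
by apply/rowP => j; rewrite !mxE.
Qed.

(** Exactness in [free_resolution] speaks of single row vectors; choosing a preimage of every row
    lifts whole matrices. *)
Lemma factor_rows (R : pzRingType) m p q (A : 'M[R]_(m, q)) (B : 'M[R]_(p, q)) :
  (forall i, exists v, row i A = v *m B) -> exists C, A = C *m B.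
Proof.
move/choose_rows => [C defA]; exists C.
by apply/row_matrixP => i; rewrite row_mul defA.
Qed.

Section LinearAlgebra.
Variable F : fieldType.

(* A map inducing an injection Z / B -> Z' / B' on homology, expressed without
   quotients. *)
Lemma rank_homology_le a b a' b' p q (Z : 'M[F]_(a, p)) (B : 'M[F]_(b, p))
    (Z' : 'M[F]_(a', q)) (B' : 'M[F]_(b', q)) (f : 'M[F]_(p, q)) (g : 'M[F]_(q, p)) :
  (Z *m f <= Z')%MS -> (B' <= Z')%MS -> (B' *m g <= B)%MS ->
  (Z *m f *m g - Z <= B)%MS -> (\rank Z - \rank B <= \rank Z' - \rank B')%N.
Proof.
move=> ZfZ' B'Z' B'gB ZfgB; pose C := (Z *m f + B')%MS.
have CZ' : (C <= Z')%MS by rewrite addsmx_sub ZfZ'.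
have B'C : (B' <= C)%MS by apply: addsmxSr.
(* Since [g] maps [B'] into [B], only a complement of [B'] in [C] counts modulo [B]. Together with
   [B] its image contains [Z], which bounds the rank of [Z]. *)
have ZfC : (Z *m f *m g <= (C :\: B') *m g + B)%MS.
  apply: (@submx_trans _ _ _ _ _ _ (((C :\: B') + C :&: B')%MS *m g)).
    by rewrite submxMr // addsmx_diff_cap_eq addsmxSl.
  rewrite addsmxMr addsmxS //.
  exact: submx_trans (submxMr g (capmxSr _ _)) B'gB.
have ZC : (Z <= (C :\: B') *m g + B)%MS.
  rewrite -[Z in (Z <= _)%MS](subKr (Z *m f *m g)) addmx_sub // eqmx_opp.
  exact: submx_trans ZfgB (addsmxSr _ _).
have rC : (\rank (C :\: B')%MS + \rank B' <= \rank Z')%N.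
  have <- : \rank (C :&: B')%MS = \rank B' by rewrite (capmx_idPr B'C).
  by rewrite addnC mxrank_cap_compl mxrankS.
rewrite leq_subLR; apply: leq_trans (mxrankS ZC) _.
apply: leq_trans (mxrank_adds_leqif _ _) _.
rewrite addnC leq_add2l leq_subRL ?mxrankS // addnC.
by apply: leq_trans rC; rewrite leq_add2r mxrankM_maxl.
Qed.
End LinearAlgebra.

(** * Independence of Tor dimensions from the free resolution *)

Section TorInvariance.
Variables (K : fieldType) (n : nat).
Local Notation S := {mpoly K[n]}.
Local Notation res0 := (map_mx (fun f : S => f@_0%MM)).

Lemma res0M m p q (A : 'M[S]_(m, p)) (B : 'M[S]_(p, q)) :
  res0 (A *m B) = res0 A *m res0 B.
Proof. exact: (map_mxM (mcoeff 0%MM : {rmorphism S -> K})). Qed.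

Lemma res0B m p (A B : 'M[S]_(m, p)) : res0 (A - B) = res0 A - res0 B.
Proof. exact: (map_mxB (mcoeff 0%MM : {rmorphism S -> K})). Qed.

Lemma res0D m p (A B : 'M[S]_(m, p)) : res0 (A + B) = res0 A + res0 B.
Proof. exact: (map_mxD (mcoeff 0%MM : {rmorphism S -> K})). Qed.

Lemma res01 m : res0 (1%:M : 'M[S]_m) = 1%:M.
Proof. exact: (map_mx1 (mcoeff 0%MM : {rmorphism S -> K})). Qed.

Lemma res00 m p : res0 (0 : 'M[S]_(m, p)) = 0.
Proof. by apply/matrixP => i j; rewrite !mxE mcoeff0. Qed.

Record is_ideal (I : S -> Prop) : Prop := {
  ideal0 : I 0;
  idealD : forall f g, I f -> I g -> I (f + g);
  idealM : forall f g, I g -> I (f * g)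
}.

Section OneIdeal.
Variables (I : S -> Prop) (idI : is_ideal I).

Lemma ideal_sum (J : finType) (F : J -> S) :
  (forall j, I (F j)) -> I (\sum_j F j).
Proof. by move=> IF; elim/big_ind: _ => //; [apply: ideal0 | apply: idealD]. Qed.

Section TwoResolutions.
Variables R R' : free_resolution I.
Local Notation d := (res_diff R).
Local Notation d' := (res_diff R').

Lemma diff_comp i : d i.+1 *m d i = 0.
Proof.
apply/row_matrixP => k; rewrite row0 row_mul.
by apply/res_diff_exact; exists (delta_mx 0 k); rewrite rowE.
Qed.

Lemma aug_comp k : I ((row k (d 0) *m res_aug R) 0 0).
Proof. by apply/res_aug_exact; exists (delta_mx 0 k); rewrite rowE. Qed.

Lemma lift_diff i m (A : 'M_(m, res_rk R i.+1)) :
  A *m d i = 0 -> exists B, A = B *m d i.+1.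
Proof.
move=> Ad0; apply: factor_rows => k.
by apply/res_diff_exact; rewrite -row_mul Ad0 row0.
Qed.

Lemma lift_aug m (A : 'M_(m, res_rk R 0)) :
  (forall k, I ((row k A *m res_aug R) 0 0)) -> exists B, A = B *m d 0.
Proof. by move=> IA; apply: factor_rows => k; apply/res_aug_exact. Qed.

(** Degree 0 of a chain map over the identity of S/I: a basis vector goes to any vector whose
    augmentation agrees with its own modulo [I]. *)
Lemma lift_id : exists f : 'M_(res_rk R 0, res_rk R' 0),
  forall u : 'rV_(res_rk R 0), I ((u *m f *m res_aug R') 0 0 - (u *m res_aug R) 0 0).
Proof.
have [f faug] := choose_rows (fun k => res_aug_surj R' (res_aug R k 0)).
exists f => u.
have -> : (u *m f *m res_aug R') 0 0 - (u *m res_aug R) 0 0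
   = \sum_k (- u 0 k) * (res_aug R k 0 - (row k f *m res_aug R') 0 0).
  rewrite -mulmxA !mxE -sumrB; apply: eq_bigr => k _.
  by rewrite -row_mul !mxE mulNr -mulrN opprB mulrBr.
by apply: ideal_sum => k; apply: idealM.
Qed.

End TwoResolutions.

Section Comparison.
Variables R R' : free_resolution I.
Local Notation d := (res_diff R).
Local Notation d' := (res_diff R').

(* The last equation is what remains of "f g - 1 = d h + h d" without the previous
   component of the homotopy h; it suffices to construct the next one. *)
Definition comparison i (f : 'M_(res_rk R i, res_rk R' i))
    (f1 : 'M_(res_rk R i.+1, res_rk R' i.+1)) (g : 'M_(res_rk R' i, res_rk R i))
    (g1 : 'M_(res_rk R' i.+1, res_rk R i.+1)) (h : 'M_(res_rk R i, res_rk R i.+1)) :=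
  [/\ d i *m f = f1 *m d' i, d' i *m g = g1 *m d i
    & d i *m (f *m g - 1%:M) = d i *m (h *m d i)].

Lemma comparison0 : exists f f1 g g1 h,
  @comparison 0 f f1 g g1 h /\ f *m g - 1%:M = h *m d 0.
Proof.
have [f If] := lift_id R R'; have [g Ig] := lift_id R' R.
have IB u v : I (u - v) -> I v -> I u.
  by move=> Iuv Iv; rewrite -[u](subrK v); apply: idealD.
have [f1 df] : exists f1, d 0 *m f = f1 *m d' 0.
  by apply: lift_aug => k; rewrite row_mul; apply: IB (If _) (aug_comp k).
have [g1 dg] : exists g1, d' 0 *m g = g1 *m d 0.
  by apply: lift_aug => k; rewrite row_mul; apply: IB (Ig _) (aug_comp k).
(* Both [f *m g] and 1 lift the identity of S/I, so their difference augments into [I]; the two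
   error terms telescope. *)
have [h fg] : exists h, f *m g - 1%:M = h *m d 0.
  apply: lift_aug => k; rewrite linearB /= row_mul mulmxBl mxE [X in _ + X]mxE.
  have := idealD idI (Ig (row k f)) (If (delta_mx 0 k)).
  by rewrite -rowE addrA subrK row1.
by exists f, f1, g, g1, h; rewrite /comparison fg.
Qed.

(** The chain maps extend because two successive differentials compose to 0. The homotopy extends
    because [f1 *m g1 - 1%:M - d i *m h] is killed by [d i], which is what the last equation of
    [comparison] provides. *)
Lemma comparisonS i f f1 g g1 h : @comparison i f f1 g g1 h ->
  exists f2 g2 h1, @comparison i.+1 f1 f2 g1 g2 h1 /\
    f1 *m g1 - 1%:M = d i *m h + h1 *m d i.+1.
Proof.
move=> [df dg dh].
have [f2 df1] : exists f2, d i.+1 *m f1 = f2 *m d' i.+1.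
  by apply: lift_diff; rewrite -mulmxA -df mulmxA diff_comp mul0mx.
have [g2 dg1] : exists g2, d' i.+1 *m g1 = g2 *m d i.+1.
  by apply: lift_diff; rewrite -mulmxA -dg mulmxA diff_comp mul0mx.
have [h1 fg1] : exists h1, f1 *m g1 - 1%:M - d i *m h = h1 *m d i.+1.
  apply: lift_diff; rewrite !mulmxBl -mulmxA -dg mulmxA -df mul1mx -[_ *m h *m _]mulmxA -dh.
  by rewrite mulmxBr mulmx1 mulmxA subrr.
exists f2, g2, h1; split; last by rewrite -fg1 [RHS]addrC subrK.
split=> //; rewrite -fg1 [in RHS]mulmxBr [d i.+1 *m (d i *m h)]mulmxA.
by rewrite diff_comp mul0mx subr0.
Qed.

Lemma comparison_exists i : exists f f1 g g1 h, @comparison i f f1 g g1 h.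
Proof.
elim: i => [|i [f [f1 [g [g1 [h /comparisonS [f2 [g2 [h1 [cmp _]]]]]]]]]].
  by have [f [f1 [g [g1 [h [cmp _]]]]]] := comparison0; exists f, f1, g, g1, h.
by exists f1, f2, g1, g2, h1.
Qed.

Lemma diff_residue_comp i : diff_residue R i.+1 *m diff_residue R i = 0.
Proof. by rewrite /diff_residue -res0M diff_comp res00. Qed.

End Comparison.

Lemma tor_dim_le (R R' : free_resolution I) i : (tor_dim R i <= tor_dim R' i)%N.
Proof.
case: i => [|i] /=.
  have [f [f1 [g [g1 [h [[_ dg _] fg]]]]]] := comparison0 R R'.
  (* In degree 0 every vector is a cycle, so the identity matrix plays the role of the cycles. *)
  rewrite -[X in (X - _ <= _)%N](mxrank1 K) -[X in (_ <= X - _)%N](mxrank1 K).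
  apply: (rank_homology_le (f := res0 f) (g := res0 g)); rewrite ?submx1 //.
    by rewrite -res0M dg res0M submxMl.
  by rewrite mul1mx -res0M -[X in _ - X](res01 _) -res0B fg res0M submxMl.
have [f [f1 [g [g1 [h cmp]]]]] := comparison_exists R R' i.
have [df _ _] := cmp.
have [f2 [g2 [h1 [[_ dg1 _] fg1]]]] := comparisonS cmp.
apply: (rank_homology_le (f := res0 f1) (g := res0 g1)).
- apply/sub_kermxP; rewrite -mulmxA -res0M -df res0M mulmxA.
  by rewrite mulmx_ker mul0mx.
- by apply/sub_kermxP; apply: diff_residue_comp.
- by rewrite -res0M dg1 res0M submxMl.
(* The homotopy survives reduction modulo the variables: on cycles its first term vanishes, and its
   second is a boundary. *)
have fg : res0 f1 *m res0 g1
    = 1%:M + diff_residue R i *m res0 h + res0 h1 *m diff_residue R i.+1.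
  by rewrite -!res0M -addrA -res0D -fg1 res0B res01 [RHS]addrC subrK.
rewrite -mulmxA fg !mulmxDr mulmx1 mulmxA mulmx_ker mul0mx addr0 addrC addKr.
by rewrite mulmxA submxMl.
Qed.

(** The given [R] shows that [epsilon] picks the value of some resolution; comparing in both
    directions identifies that value with the one of [R]. *)
Lemma betti_tor_dim (R : free_resolution I) i : betti I i = tor_dim R i.
Proof.
rewrite /betti; have [R' ->] := epsilon_spec (inhabits 0%N)
  (fun b => exists R' : free_resolution I, b = tor_dim R' i)
  (ex_intro _ (tor_dim R i) (ex_intro _ R erefl)).
by apply/eqP; rewrite eqn_leq !tor_dim_le.
Qed.

End OneIdeal.
End TorInvariance.

(** * Squarefree monomials and divisibility by them *)

Section SquarefreeMonomials.
Variables (K : fieldType) (n : nat).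
Local Notation S := {mpoly K[n]}.
Implicit Types (A B : {set 'I_n}) (m : 'X_{1..n}) (f g : S).

Definition sqfree A : 'X_{1..n} := [multinom (i \in A : nat) | i < n].

Definition msupport m : {set 'I_n} := [set i | (0 < m i)%N].

Lemma sqfree_le A m : (sqfree A <= m)%MM = (A \subset msupport m).
Proof.
apply/mnm_lepP/subsetP => [le_m i iA | sub i]; last first.
  by rewrite mnmE; case: (boolP (i \in A)) => // /sub; rewrite inE.
by have := le_m i; rewrite mnmE iA inE.
Qed.

Lemma sqfreeD A B : B \subset A -> (sqfree (A :\: B) + sqfree B)%MM = sqfree A.
Proof.
move=> /subsetP BA; apply/mnmP => i; rewrite mnmDE !mnmE !inE.
by case: (boolP (i \in B)) => [/BA ->|]; rewrite ?addn0.
Qed.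

Lemma sqfree_eq0 A : (sqfree A == 0%MM) = (A == set0).
Proof.
apply/eqP/eqP => [A0|->]; last by apply/mnmP => i; rewrite !mnmE inE.
by apply/setP => i; have /mnmP/(_ i) := A0; rewrite !mnmE inE; case: (i \in A).
Qed.

Lemma msupport_add m m' : msupport (m + m') = msupport m :|: msupport m'.
Proof. by apply/setP => i; rewrite !inE mnmDE addn_gt0. Qed.

Lemma msupport_sqfree A : msupport (sqfree A) = A.
Proof. by apply/setP => i; rewrite inE mnmE; case: (i \in A). Qed.

Definition supported A f := forall m, f@_m != 0 -> A \subset msupport m.

Lemma supportedMX A f : supported A (f * 'X_[sqfree A]).
Proof.
move=> m; rewrite -mcoeff_msupp (perm_mem (msuppMX _ _)) => /mapP[m' _ ->].
by rewrite msupport_add msupport_sqfree subsetUl.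
Qed.

Lemma supportedP A f : supported A f -> exists g, f = g * 'X_[sqfree A].
Proof.
move=> suppf; exists (\sum_(m <- msupp f) f@_m *: 'X_[m - sqfree A]).
rewrite {1}[f]mpolyE mulr_suml big_seq [RHS]big_seq; apply: eq_bigr => m.
rewrite mcoeff_msupp => /suppf; rewrite -sqfree_le => le_m.
by rewrite -scalerAl -mpolyXD submK.
Qed.

Lemma mulXI m : injective (fun f => f * 'X_[m]).
Proof. by move=> f g eq_fg; apply/mpolyP => k; rewrite -(mcoeffMX f m k) eq_fg mcoeffMX. Qed.

End SquarefreeMonomials.

Lemma sum_enum_rank (V : nmodType) (T : finType) (F : 'I_#|T| -> V) :
  \sum_a F a = \sum_(t : T) F (enum_rank t).
Proof. exact: reindex (onW_bij _ (enum_rank_bij T)). Qed.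

(** * The resolution of a squarefree monomial ideal on tuples of generators *)

Section TupleResolution.
Variables (K : fieldType) (n : nat) (J : finType).
Local Notation S := {mpoly K[n]}.

Fixpoint cell k : finType := if k is k'.+1 then (J * cell k')%type else unit.

(* Coefficients of the differential d(j, s) = s - (j, d s), an unfolding of the
   alternating sum of the faces of a tuple. *)
Fixpoint face k : cell k.+1 -> cell k -> K :=
  if k is k'.+1 return cell k.+1 -> cell k -> K
  then fun s t => (s.2 == t)%:R - (s.1 == t.1)%:R * face s.2 t.2
  else fun _ _ => 1.

Definition boundary k (u : cell k.+1 -> S) (t : cell k) : S :=
  \sum_s face s t *: u s.

Lemma sum_cellS k (F : cell k.+1 -> S) : \sum_s F s = \sum_j \sum_t F (j, t).
Proof. by rewrite pair_bigA; apply: eq_bigr; case. Qed.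

Lemma boundary0 (u : cell 1 -> S) : boundary u tt = \sum_j u (j, tt).
Proof.
rewrite /boundary sum_cellS; apply: eq_bigr => j _.
by rewrite (big_pred1 tt) ?scale1r //; case.
Qed.

(** The coefficient form of d(j, s) = s - (j, d s): the tuple (j, t) arises by dropping a first
    entry [i], or by keeping [j] and taking a face of the tail. *)
Lemma boundaryS k (u : cell k.+2 -> S) j (t : cell k) :
  boundary u (j, t) =
  \sum_i u (i, (j, t)) - boundary (fun s : cell k.+1 => u (j, s)) t.
Proof.
rewrite /boundary; under eq_bigr do rewrite scalerBl.
rewrite sumrB; congr (_ - _).
  rewrite [LHS]sum_cellS; apply: eq_bigr => i _.
  rewrite (bigD1 (j, t)) //= eqxx scale1r big1 ?addr0 //.
  by move=> s /negPf ->; rewrite scale0r.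
rewrite [LHS]sum_cellS (bigD1 j) //= eqxx [X in _ + X]big1 ?addr0.
  by apply: eq_bigr => s _; rewrite mul1r.
by move=> i /negPf ->; rewrite big1 // => s _; rewrite mul0r scale0r.
Qed.

Lemma eq_boundary k (u v : cell k.+1 -> S) : u =1 v -> boundary u =1 boundary v.
Proof. by move=> uv t; apply: eq_bigr => s _; rewrite uv. Qed.

Lemma boundary_sum k (I : finType) (u : I -> cell k.+1 -> S) t :
  boundary (fun s => \sum_i u i s) t = \sum_i boundary (u i) t.
Proof. by rewrite exchange_big; apply: eq_bigr => s _; rewrite scaler_sumr. Qed.

Lemma boundaryB k (u v : cell k.+1 -> S) t :
  boundary (fun s => u s - v s) t = boundary u t - boundary v t.
Proof. by rewrite -sumrB; apply: eq_bigr => s _; rewrite scalerBr. Qed.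

Lemma boundaryK k (u : cell k.+2 -> S) t : boundary (boundary u) t = 0.
Proof.
elim: k u t => [|k IHk] u t.
  case: t; rewrite boundary0.
  under eq_bigr do rewrite boundaryS boundary0.
  by rewrite sumrB exchange_big subrr.
case: t => j t; rewrite boundaryS.
under eq_bigr do rewrite boundaryS boundaryS.
rewrite (eq_boundary (v := fun s => \sum_i u (i, (j, s))
  - boundary (fun s' : cell k.+2 => u (j, s')) s)); last first.
  by move=> s; rewrite boundaryS.
(* The induction hypothesis removes the double boundary with [j] fixed; the double sums over two new
   first entries cancel by symmetry, and the remaining single sums agree. *)
rewrite boundaryB IHk subr0 boundary_sum.
by rewrite !sumrB exchange_big /= subKr subrr.
Qed.

Variable L : J -> {set 'I_n}.

(** The support of the lcm of the generators in the tuple. *)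
Fixpoint label k : cell k -> {set 'I_n} :=
  if k is k'.+1 return cell k -> {set 'I_n}
  then fun s => L s.1 :|: label s.2 else fun _ => set0.

(** Faces only drop generators. Hence the monomial in each nonzero entry of [tuple_diff] is a
    genuine quotient of two lcms. *)
Lemma face_label k (s : cell k.+1) (t : cell k) :
  face s t != 0 -> label t \subset label s.
Proof.
elim: k s t => [|k IHk] /= [i s] t; first by rewrite sub0set.
have [<- _|_] := eqVneq s t; first exact: subsetUr.
have [->|_] := eqVneq i t.1; rewrite /= ?mul0r ?subrr ?eqxx //.
by rewrite mul1r sub0r oppr_eq0 => /IHk sub; apply: setUS.
Qed.

(** The choice depends on the monomial alone, so splitting by it commutes with [boundary], whose
    coefficients are constants. *)
Definition first_gen (m : 'X_{1..n}) : option J := [pick j | L j \subset msupport m].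

Definition gen_part j (f : S) : S :=
  \sum_(m <- msupp f | first_gen m == Some j) f@_m *: 'X_[m].

Lemma mcoeff_gen_part j f m :
  (gen_part j f)@_m = if first_gen m == Some j then f@_m else 0.
Proof.
rewrite raddf_sum /=; under eq_bigr do rewrite mcoeffZ mcoeffX.
rewrite big_mkcond /=; have [mf|] := boolP (m \in msupp f).
  rewrite (bigD1_seq m) ?msupp_uniq //= eqxx mulr1 big1 ?addr0 // => k /negPf ->.
  by rewrite mulr0 if_same.
move=> mf; rewrite memN_msupp_eq0 // if_same big1_seq // => k /andP[_ kf].
by case: (eqVneq k m) kf mf => [-> ->|_ _ _]; rewrite ?mulr0 ?if_same.
Qed.

Definition monomial_ideal (f : S) :=
  forall m, f@_m != 0 -> exists j, L j \subset msupport m.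

Lemma sum_gen_part f : monomial_ideal f -> \sum_j gen_part j f = f.
Proof.
move=> If; apply/mpolyP => m; rewrite raddf_sum /=.
under eq_bigr do rewrite mcoeff_gen_part.
have [->|/If ex] := eqVneq f@_m 0; first by rewrite big1 // => j _; case: ifP.
rewrite /first_gen; case: pickP => [i _|none]; last first.
  by case: ex => j; rewrite none.
rewrite (bigD1 i) //= eqxx big1 ?addr0 // => j ji.
by case: eqP => // -[ij]; rewrite ij eqxx in ji.
Qed.

Lemma gen_part_boundary k (u : cell k.+1 -> S) t j :
  gen_part j (boundary u t) = boundary (fun s => gen_part j (u s)) t.
Proof.
apply/mpolyP => m; rewrite mcoeff_gen_part !raddf_sum /=.
case: ifP => m_j; last first.
  by rewrite big1 // => s _; rewrite mcoeffZ mcoeff_gen_part m_j mulr0.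
by apply: eq_bigr => s _; rewrite !mcoeffZ mcoeff_gen_part m_j.
Qed.

Lemma gen_part_supported A f j :
  supported A f -> supported (L j :|: A) (gen_part j f).
Proof.
move=> suppf m; rewrite mcoeff_gen_part /first_gen.
case: pickP => [i Li|_]; last by rewrite eqxx.
case: (Some i =P Some j) => [[<-]|_]; last by rewrite eqxx.
by rewrite subUset Li => /suppf.
Qed.

Lemma monomial_ideal0 : monomial_ideal 0.
Proof. by move=> m; rewrite mcoeff0 eqxx. Qed.

(* A contracting homotopy: in each multidegree, prepend one fixed generator
   dividing the monomial of that degree. *)
Definition cone k (u : cell k -> S) : cell k.+1 -> S := fun s => gen_part s.1 (u s.2).

Lemma boundary_cone0 (u : cell 0 -> S) :
  monomial_ideal (u tt) -> boundary (cone u) tt = u tt.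
Proof. by move=> Iu; rewrite /cone boundary0 /= sum_gen_part. Qed.

Definition labelled k (u : cell k -> S) := forall s, supported (label s) (u s).

(** The identity d c + c d = 1, with c the cone, evaluated on a cycle. Labels ensure that each
    monomial of [u] is divisible by a generator, namely the first entry of its tuple. *)
Lemma boundary_coneS k (u : cell k.+1 -> S) :
  labelled u -> (forall t, boundary u t = 0) -> forall s, boundary (cone u) s = u s.
Proof.
move=> lab_u du0 [j t]; rewrite /cone boundaryS /= sum_gen_part.
  rewrite -gen_part_boundary /= du0.
  by rewrite /gen_part msupp0 big_nil subr0.
by move=> m /lab_u; rewrite subUset => /andP[Lj _]; exists j.
Qed.

Lemma labelled_cone k (u : cell k -> S) : labelled u -> labelled (cone u).
Proof. by move=> lab_u s; apply/gen_part_supported/lab_u. Qed.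

Definition tuple_diff k : 'M[S]_(#|cell k.+1|, #|cell k|) :=
  \matrix_(a, b) (face (enum_val a) (enum_val b)
    *: 'X_[sqfree (label (enum_val a) :\: label (enum_val b))]).

(* Rescaling each basis vector by its label identifies the resolution with a
   subcomplex of one whose differential has constant coefficients. *)
Definition rescale k (u : 'rV[S]_#|cell k|) (s : cell k) : S :=
  u 0 (enum_rank s) * 'X_[sqfree (label s)].

Lemma rescale_inj k (u v : 'rV[S]_#|cell k|) : rescale u =1 rescale v -> u = v.
Proof.
move=> uv; apply/rowP => a; apply: (@mulXI _ _ (sqfree (label (enum_val a)))).
by have := uv (enum_val a); rewrite /rescale enum_valK.
Qed.

Lemma rescale_labelled k (u : 'rV[S]_#|cell k|) : labelled (rescale u).
Proof. by move=> s; apply: supportedMX. Qed.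

Lemma rescale_surj k (w : cell k -> S) :
  labelled w -> exists u : 'rV[S]_#|cell k|, rescale u =1 w.
Proof.
move=> lab_w; have wit s :=
  constructive_indefinite_description _ (supportedP (lab_w s)).
exists (\row_a sval (wit (enum_val a))) => s; rewrite /rescale mxE enum_rankK.
by case: (wit s) => /= g ->.
Qed.

Lemma rescale_diff k (u : 'rV[S]_#|cell k.+1|) :
  rescale (u *m tuple_diff k) =1 boundary (rescale u).
Proof.
move=> t; rewrite /rescale mxE mulr_suml sum_enum_rank; apply: eq_bigr => s _.
rewrite mxE !enum_rankK.
have [->|/face_label sub] := eqVneq (face s t) 0.
  by rewrite !scale0r mulr0 mul0r.
by rewrite -scalerAr -scalerAl -mulrA -mpolyXD sqfreeD.
Qed.

Lemma tuple_diff_exact k (u : 'rV_#|cell k.+1|) :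
  u *m tuple_diff k = 0 <-> exists v, u = v *m tuple_diff k.+1.
Proof.
split=> [ud0|[v ->]].
  (* The cone of a labelled cycle is again labelled, so it comes from a vector of the resolution
     itself. *)
  have [v vE] := rescale_surj (labelled_cone (rescale_labelled (u := u))).
  exists v; apply: rescale_inj => s; rewrite rescale_diff (eq_boundary vE).
  rewrite boundary_coneS //; first exact: rescale_labelled.
  by move=> t; rewrite -rescale_diff ud0 /rescale mxE mul0r.
apply: rescale_inj => t; rewrite rescale_diff (eq_boundary (rescale_diff v)) boundaryK.
by rewrite /rescale mxE mul0r.
Qed.

Lemma rescale_tt (u : 'rV_#|cell 0|) : (u *m const_mx 1 : 'M_1) 0 0 = rescale u tt.
Proof.
rewrite mxE sum_enum_rank (big_pred1 tt); last by case.
rewrite mxE mulr1 /rescale.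
by have /eqP -> : sqfree (set0 : {set 'I_n}) == 0%MM; rewrite ?sqfree_eq0 // mpolyX0 mulr1.
Qed.

Lemma tuple_aug_exact (u : 'rV_#|cell 0|) :
  monomial_ideal ((u *m const_mx 1 : 'M_1) 0 0) <-> exists v, u = v *m tuple_diff 0.
Proof.
rewrite rescale_tt; split=> [Iu|[v ->]].
  have [v vE] := rescale_surj (labelled_cone (rescale_labelled (u := u))).
  exists v; apply: rescale_inj => -[]; rewrite rescale_diff (eq_boundary vE).
  by rewrite boundary_cone0.
(* A monomial of the sum occurs in some summand, hence is divisible by the generator labelling
   it. *)
move=> m; rewrite rescale_diff boundary0 raddf_sum /= => nz.
have [j nzj] : exists j, (rescale v (j, tt))@_m != 0.
  apply/existsP; apply: contraNT nz => /existsPn nz.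
  by rewrite big1 // => j _; apply/eqP; rewrite -[_ == _]negbK nz.
by exists j; have := rescale_labelled nzj; rewrite /= setU0.
Qed.

Lemma tuple_aug_surj f : exists u : 'rV[S]_#|cell 0|,
  monomial_ideal (f - (u *m const_mx 1 : 'M_1) 0 0).
Proof.
exists (const_mx f); rewrite mxE sum_enum_rank (big_pred1 tt); last by case.
by rewrite !mxE mulr1 subrr; apply: monomial_ideal0.
Qed.

Definition tuple_resolution : free_resolution monomial_ideal :=
  Build_free_resolution tuple_aug_surj tuple_aug_exact tuple_diff_exact.

Lemma monomial_ideal_is_ideal : is_ideal monomial_ideal.
Proof.
split; first exact: monomial_ideal0.
  move=> f g If Ig m; rewrite mcoeffD.
  by have [->|/If //] := eqVneq f@_m 0; rewrite add0r => /Ig.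
move=> f g Ig m; rewrite -mcoeff_msupp => /msuppM_le/allpairsP[[m1 m2] /=] [_ m2g ->].
have [|j Lj] := Ig m2; first by rewrite -mcoeff_msupp.
by exists j; rewrite msupport_add (subset_trans Lj) ?subsetUr.
Qed.

End TupleResolution.

(** Modulo the variables an entry of [tuple_diff] keeps its scalar if its monomial is 1 and vanishes
    otherwise; the monomial is 1 exactly when the label of the tuple is contained in that of the
    face. So inclusions between labels determine the residual complex. *)
Lemma betti_monomial_ideal (K : fieldType) n (J : finType) (L L' : J -> {set 'I_n}) :
  (forall k l (s : cell J k) (t : cell J l),
     (label L s \subset label L t) = (label L' s \subset label L' t)) ->
  forall i, betti (monomial_ideal (K := K) L) i = betti (monomial_ideal (K := K) L') i.
Proof.
move=> sub_label i.
rewrite !(betti_tor_dim (monomial_ideal_is_ideal _ _) (tuple_resolution _ _)).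
have eq_res k : diff_residue (tuple_resolution K L) k
    = diff_residue (tuple_resolution K L') k.
  apply/matrixP => a b; rewrite !mxE !mcoeffZ !mcoeffX !sqfree_eq0 !setD_eq0.
  by rewrite sub_label.
by case: i => [|i] /=; rewrite !eq_res.
Qed.

(** * Cover ideals as monomial ideals *)

Section CoverIdealMonomials.
Variables (K : fieldType) (n : nat).
Local Notation S := {mpoly K[n]}.

Lemma variable_ideal_monomials (F : {set 'I_n}) (f : S) :
  variable_ideal F f <-> forall m, f@_m != 0 -> ~~ [disjoint F & msupport m].
Proof.
split=> [[c ->] m|meet].
  rewrite raddf_sum /= => nz.
  have [i /andP[iF nzi]] : exists i, (i \in F) && ((c i * 'X_i)@_m != 0).
    apply/existsP; apply: contraNT nz => /existsPn nz.
    rewrite big1 // => i iF; apply/eqP; rewrite -[_ == _]negbK.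
    by have := nz i; rewrite iF.
  rewrite -mcoeff_msupp (perm_mem (msuppMX _ _)) in nzi.
  case/mapP: nzi => m' _ ->; apply/pred0Pn; exists i.
  by rewrite /= iF inE mnmDE mnm1E eqxx.
have add g h : variable_ideal F g -> variable_ideal F h -> variable_ideal F (g + h).
  move=> [c ->] [c' ->]; exists (fun i => c i + c' i).
  by rewrite -big_split; apply: eq_bigr => i _; rewrite mulrDl.
rewrite [f]mpolyE big_seq; elim/big_rec: _ => [|m h].
  by exists (fun=> 0); rewrite big1 // => i _; rewrite mul0r.
rewrite mcoeff_msupp => /meet /pred0Pn[i /andP[/= iF mi]].
rewrite inE in mi; apply: add.
(* A monomial meeting [F] is divided by one variable [i] of [F] that it contains. *)
exists (fun j => if j == i then f@_m *: 'X_[m - U_(i)] else 0).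
rewrite (bigD1 i) //= eqxx -scalerAl -mpolyXD submK.
  by rewrite big1 ?addr0 // => j /andP[_ /negPf ->]; rewrite mul0r.
by apply/mnm_lepP => j; rewrite mnm1E; have [<-|_] := eqVneq i j.
Qed.

Lemma cover_ideal_monomials (Delta : {set {set 'I_n}}) (f : S) :
  cover_ideal K Delta f <-> forall m, f@_m != 0 ->
    forall F, is_facet Delta F -> ~~ [disjoint F & msupport m].
Proof.
split=> [If m nz F facF|If F facF].
  by have /variable_ideal_monomials := If F facF; apply.
by apply/variable_ideal_monomials => m nz; apply: If.
Qed.

(** Both sides are tested on supports of monomials. Extensionality turns the equivalence into an
    equality of predicates, which can be rewritten inside [betti]. *)
Lemma cover_idealE (Delta : {set {set 'I_n}}) (J : finType) (L : J -> {set 'I_n}) :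
  (forall M : {set 'I_n}, (forall F, is_facet Delta F -> ~~ [disjoint F & M]) <->
     exists j, L j \subset M) ->
  cover_ideal K Delta = monomial_ideal L.
Proof.
move=> covers; apply: functional_extensionality => f; apply: propositional_extensionality.
by rewrite cover_ideal_monomials; split=> If m nz; apply/covers; apply: If.
Qed.

End CoverIdealMonomials.

(** * Exchanging parallel elements in faces of a matroid *)

Section SimplifiedMatroid.
Variables (n : nat) (Delta P : {set {set 'I_n}}) (W : {set 'I_n}).
Hypothesis matD : matroid_complex Delta.
Hypothesis skelP : complete_multipartite_skeleton Delta P.
Hypothesis transW : is_transversal W P [set: 'I_n].
Implicit Types (F G T M U : {set 'I_n}).

Definition representative x := transversal_repr x W (pblock P x).
Local Notation r := representative.

Lemma pblock_in x : pblock P x \in P.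
Proof.
have [partP _] := skelP; apply: pblock_mem.
by rewrite (cover_partition partP) inE.
Qed.

Lemma representative_in x : r x \in W.
Proof. exact: repr_mem_transversal transW _ _ (pblock_in x). Qed.

Lemma pblock_representative x : pblock P (r x) = pblock P x.
Proof. exact: (transversal_reprK transW _ (pblock_in x)). Qed.

Lemma representative_id x : x \in W -> r x = x.
Proof. exact: (pblockK transW). Qed.

(** Two distinct elements of one class form a non-edge, so no face contains both. *)
Lemma pblock_face_inj F : F \in Delta -> {in F &, injective (pblock P)}.
Proof.
move=> FD x y xF yF eq_xy; apply: contraTeq FD => ne_xy; apply/negP => FD.
have [_ /(_ x y ne_xy)] := skelP; rewrite eq_xy eqxx.
have -> // : [set x; y] \in Delta.
by apply: (matroid_down matD FD); rewrite subUset !sub1set xF.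
Qed.

Lemma face_extend F G : F \in Delta -> G \in Delta -> (#|F| <= #|G|)%N ->
  exists H : {set 'I_n}, [/\ H \in Delta, F \subset H, H \subset F :|: G & #|H| = #|G|].
Proof.
move=> FD GD; have [k] := ubnP (#|G| - #|F|)%N.
elim: k F FD => // k IHk F FD lt_k; rewrite leq_eqVlt => /predU1P[eqFG|ltFG].
  by exists F; rewrite subsetUl.
have [i] := matroid_exchange matD FD GD ltFG; rewrite inE => /andP[iF iG] iFD.
have cardF : #|i |: F| = #|F|.+1 by rewrite cardsU1 iF.
have [||H [HD sFH sHG cardH]] := IHk _ iFD; rewrite ?cardF //.
  by rewrite subnS prednK ?subn_gt0 // -ltnS.
exists H; split=> //; first exact: subset_trans (subsetUr _ _) sFH.
by apply: subset_trans sHG _; rewrite -setUA subUset subxx sub1set inE iG orbT.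
Qed.

(** Exchange extends [[set y]] within [y |: F] to a face of the size of [F]. If [y] is not in [F],
    this face cannot contain the parallel element [x], so it is [F] with [x] swapped for [y]. *)
Lemma face_replace F x y : F \in Delta -> x \in F -> pblock P y = pblock P x ->
  y |: (F :\ x) \in Delta.
Proof.
move=> FD xF eq_yx; have F_gt0 : (#|[set y]| <= #|F|)%N.
  by rewrite cards1 card_gt0; apply/set0Pn; exists x.
have [H [HD yH sHF cardH]] := face_extend (matroid_vertex matD y) FD F_gt0.
suff -> : y |: F :\ x = H by [].
rewrite sub1set in yH.
have [yF|yF] := boolP (y \in F).
  have eqyx : y = x by apply: (pblock_face_inj FD).
  rewrite eqyx setD1K //; apply/esym/eqP; rewrite eqEcard cardH leqnn andbT.
  by apply: subset_trans sHF _; rewrite subUset sub1set yF subxx.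
have card_repl : #|y |: F :\ x| = #|F|.
  by rewrite cardsU1 !inE (negPf yF) andbF (cardsD1 x F) xF.
apply/esym/eqP; rewrite eqEcard cardH card_repl leqnn andbT.
apply/subsetP => z zH; have := subsetP sHF z zH; rewrite !inE.
case/predU1P => [->|zF]; first by rewrite eqxx.
rewrite zF andbT; case: (eqVneq z y) => //= _; apply/eqP => zx.
by case/negP: yF; rewrite -(pblock_face_inj HD _ _ (esym eq_yx)) // -zx.
Qed.

Section Replacement.
Variable g : 'I_n -> 'I_n.
Hypothesis pblock_g : forall x, pblock P (g x) = pblock P x.

Lemma card_replacement F : F \in Delta -> #|g @: F| = #|F|.
Proof.
move=> FD; apply: card_in_imset => x y xF yF eqg.
by apply: (pblock_face_inj FD) => //; rewrite -pblock_g eqg pblock_g.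
Qed.

Lemma face_replacement F : F \in Delta -> g @: F \in Delta.
Proof.
(* Elements are replaced one at a time; [A] collects those already replaced. *)
move=> FD; suff : forall A : {set 'I_n}, A \subset F -> (F :\: A) :|: g @: A \in Delta.
  by move=> /(_ F (subxx _)); rewrite setDv set0U.
move=> A; have [k] := ubnP #|A|; elim: k A => // k IHk A leAk sAF.
have [->|[x xA]] := set_0Vmem A; first by rewrite imset0 setU0 setD0.
have xF := subsetP sAF x xA.
have A'F : A :\ x \subset F := subset_trans (subsetDl _ _) sAF.
have := IHk (A :\ x); rewrite (cardsD1 x A) xA ltnS in leAk; move=> /(_ leAk A'F) BD.
have xB : x \in (F :\: (A :\ x)) :|: g @: (A :\ x) by rewrite !inE eqxx xF.
(* Otherwise deleting [x] from the mixed face would also delete a replaced element; its preimage in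
   [F] would be parallel to [x]. *)
have xg : x \notin g @: (A :\ x).
  apply/imsetP => -[a]; rewrite !inE => /andP[ax aA] xga.
  case/eqP: ax; apply: (pblock_face_inj FD) => //; first exact: subsetP aA.
  by rewrite xga pblock_g.
have := face_replace BD xB (pblock_g x).
congr (_ \in Delta); rewrite -{4}(setD1K xA) imsetU1 setUCA; congr (_ |: _).
apply/setP => z; rewrite !inE.
by case: (eqVneq z x) => [->|_] //=; rewrite xA (negPf xg).
Qed.

End Replacement.

(** * Facets and vertex covers of the matroid and its simplification *)

Lemma facet_restrictionP U F :
  is_facet (restriction Delta U) F <->
  F \in restriction Delta U /\ forall G, G \in restriction Delta U -> (#|G| <= #|F|)%N.
Proof.
split=> [/maxsetP[FU maxF]|[FU maxF]].
  split=> // G GU; rewrite leqNgt; apply/negP => ltFG.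
  move: FU GU; rewrite !inE => /andP[FD FU] /andP[GD GU].
  (* A larger face inside [U] would enlarge [F] by an element of [U], against maximality. *)
  have [i] := matroid_exchange matD FD GD ltFG; rewrite inE => /andP[iF iG] iFD.
  case/negP: iF; rewrite -(maxF (i |: F)) ?setU11 ?subsetUr //.
  by rewrite inE iFD subUset sub1set (subsetP GU) //.
apply/maxsetP; split=> // G GU sFG; apply/esym/eqP.
by rewrite eqEcard sFG maxF.
Qed.

Lemma facet_replacement g U U' F :
  (forall x, pblock P (g x) = pblock P x) ->
  W \subset U -> {in F, forall x, g x \in U'} -> is_facet (restriction Delta U) F ->
  is_facet (restriction Delta U') (g @: F).
Proof.
move=> pblock_g WU gU' /facet_restrictionP[]; rewrite inE => /andP[FD FU] maxF.
apply/facet_restrictionP; split.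
  by rewrite inE face_replacement //; apply/subsetP => _ /imsetP[x xF ->]; apply: gU'.
move=> G; rewrite inE => /andP[GD _].
(* Any competing face [G] is moved into [W], hence into [U], without changing its size; there [F] is
   largest. *)
rewrite card_replacement // -(card_replacement pblock_representative GD) maxF //.
rewrite inE face_replacement //; last exact: pblock_representative.
apply/subsetP => _ /imsetP[x _ ->]; exact: (subsetP WU) (representative_in x).
Qed.

Lemma restrictionT : restriction Delta [set: 'I_n] = Delta.
Proof. by apply/setP => F; rewrite inE subsetT andbT. Qed.

(** All covers inside [W] serve as generators, minimal or not; the tuple resolution allows redundant
    generators. *)
Definition cover_of T :=
  (T \subset W) && [forall F, is_facet (restriction Delta W) F ==> ~~ [disjoint F & T]].

Lemma restriction_covers M :
  (forall F, is_facet (restriction Delta W) F -> ~~ [disjoint F & M]) <->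
  exists T : {T | cover_of T}, val T \subset M.
Proof.
split=> [meet|[[T /= /andP[_ /forallP coverT]] TM] F facF].
  have coverT : cover_of (M :&: W).
    rewrite /cover_of subsetIr; apply/forallP => F; apply/implyP => facF.
    have /pred0Pn[x /andP[/= xF xM]] := meet F facF.
    apply/pred0Pn; exists x; rewrite /= xF inE xM.
    have /facet_restrictionP[] := facF; rewrite inE => /andP[_ FW] _.
    exact: subsetP xF.
  by exists (exist cover_of _ coverT); apply: subsetIl.
by have /implyP/(_ facF) := coverT F; apply: contraNN; apply: disjointWr.
Qed.

Lemma covers M :
  (forall F, is_facet Delta F -> ~~ [disjoint F & M]) <->
  exists T : {T | cover_of T}, r @^-1: val T \subset M.
Proof.
rewrite -{1}restrictionT.
split=> [meet|[[T /= /andP[_ /forallP coverT]] TM] F facF]; last first.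
  have := coverT (r @: F); rewrite (facet_replacement _ _ _ facF) ?subsetT //; first last.
  - by move=> x _; apply: representative_in.
  - exact: pblock_representative.
  case/pred0Pn => _ /andP[/imsetP[x xF ->] /= rxT]; apply/pred0Pn; exists x.
  by rewrite /= xF (subsetP TM) // inE.
(* The representatives whose entire class lies in [M]. *)
pose T := [set w in W | r @^-1: [set w] \subset M].
have coverT : cover_of T.
  apply/andP; split; first by apply/subsetP => w; rewrite inE => /andP[].
  apply/forallP => F; apply/implyP => facF; apply/negP => disFT.
  (* If a facet [F] missed [T], every vertex of [F] would have a parallel element outside [M];
     moving [F] along [g] gives a facet of [Delta] disjoint from [M]. *)
  pose g w := odflt w [pick x | (r x == w) && (x \notin M)].
  have pblock_g w : pblock P (g w) = pblock P w.
    by rewrite /g; case: pickP => //= x /andP[/eqP <- _]; rewrite pblock_representative.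
  have facgF := facet_replacement pblock_g (subxx _) (fun x _ => in_setT (g x)) facF.
  have /pred0Pn[_ /andP[/imsetP[w wF ->]]] := meet _ facgF.
  have : w \notin T by rewrite (disjointFr disFT wF).
  have /facet_restrictionP[] := facF; rewrite inE => /andP[_ /subsetP/(_ w wF) wW] _.
  rewrite inE wW /= => /subsetPn[x]; rewrite !inE => rx xM.
  rewrite /g; case: pickP => [y /andP[_ /negPf /= ->] //|/(_ x)].
  by rewrite rx xM.
exists (exist cover_of _ coverT); apply/subsetP => x /=; rewrite !inE => /andP[_ /subsetP]; apply.
by rewrite !inE.
Qed.

(** * Comparison of Betti numbers and types *)

Lemma label_preimset (J : finType) (L : J -> {set 'I_n}) k (s : cell J k) :
  label (fun j => r @^-1: L j) s = r @^-1: label L s.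
Proof.
elim: k s => [_|k IHk [j s]] /=; first by apply/setP => x; rewrite !inE.
by rewrite preimsetU IHk.
Qed.

Lemma label_sub (J : finType) (L : J -> {set 'I_n}) k (s : cell J k) :
  (forall j, L j \subset W) -> label L s \subset W.
Proof.
by move=> LW; elim: k s => [_|k IHk [j s]] /=; rewrite ?sub0set // subUset LW IHk.
Qed.

(** Each element of [W] is its own representative, so a subset of [W] can be read off its
    preimage. *)
Lemma preimset_sub T T' : T \subset W -> (r @^-1: T \subset r @^-1: T') = (T \subset T').
Proof.
move=> /subsetP TW; apply/idP/idP => [/subsetP sub|]; last exact: preimsetS.
apply/subsetP => w wT; have := sub w; rewrite !inE representative_id ?TW //.
by apply.
Qed.

Lemma betti_restriction (K : fieldType) i :
  betti (cover_ideal K Delta) i = betti (cover_ideal K (restriction Delta W)) i.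
Proof.
rewrite (cover_idealE K covers) (cover_idealE K restriction_covers).
apply: betti_monomial_ideal => k l s t; rewrite !label_preimset preimset_sub //.
by apply: label_sub => -[T /= /andP[]].
Qed.

(** [cm_type] takes its index from the largest face of its own complex; passing to representatives
    moves a largest face into [W] at the same size. *)
Lemma rank_restriction : (\max_(F in Delta) #|F| = \max_(F in restriction Delta W) #|F|)%N.
Proof.
apply/eqP; rewrite eqn_leq; apply/andP; split; apply/bigmax_leqP => F FD.
  rewrite -(card_replacement pblock_representative FD); apply: leq_bigmax_cond.
  rewrite inE face_replacement //; last exact: pblock_representative.
  by apply/subsetP => _ /imsetP[x _ ->]; apply: representative_in.
by apply: leq_bigmax_cond; move: FD; rewrite inE => /andP[].
Qed.

End SimplifiedMatroid.

Theorem proposition2p8 (K : fieldType) (n : nat) (Delta : {set {set 'I_n}})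
    (hDelta : matroid_complex Delta)
    (P : {set {set 'I_n}}) (hP : complete_multipartite_skeleton Delta P)
    (W : {set 'I_n}) (hW : is_transversal W P [set: 'I_n]) :
  (forall i : nat,
     betti (cover_ideal K Delta) i = betti (cover_ideal K (restriction Delta W)) i)
  /\ cm_type K Delta = cm_type K (restriction Delta W).
Proof.
split=> [i|]; first exact: betti_restriction hDelta hP hW K i.
by rewrite /cm_type (betti_restriction hDelta hP hW) (rank_restriction hDelta hP hW).
Qed.
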